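(* Let $F,G$ be parallel 1-cells (lax double functors) in the bicategory $\mathsf{DoubleCat}$ of univalent double categories and let $(\tau,\bar\tau)$ be a 2-cell from $F$ to $G$ in $\mathsf{DoubleCat}$. Then this 2-cell is invertible if and only if its underlying natural transformation $\tau$ and its underlying 2-sided displayed natural transformation $\bar\tau$ are pointwise isomorphisms, i.e. every component $\tau_x$ is an isomorphism and every component $\bar\tau(h)$ is an isomorphism of displayed objects.
   Context: We work in univalent foundations: Martin-Löf type theory with the univalence axiom. Categories have hom-sets; a category is univalent if the canonical map from $x=y$ to isomorphisms $x\cong y$ is an equivalence of types for all $x,y$. Composition is in diagrammatic order. $a=_*b$ denotes equality in a type family over a canonical equality in the base (equality after transport). 2-sided displayed categories. A 2-sided displayed category $D$ over categories $C_1,C_2$ consists of: for $x_1:C_1$, $x_2:C_2$ a type $D_{(x_1,x_2)}$ of displayed objects; for $\bar x:D_{(x_1,x_2)}$, $\bar y:D_{(y_1,y_2)}$, $f_1:x_1\to y_1$, $f_2:x_2\to y_2$ a set $\bar x\to_{(f_1,f_2)}\bar y$ of displayed morphisms; displayed identities $\overline{\mathsf{id}}_{\bar x}:\bar x\to_{(\mathsf{id},\mathsf{id})}\bar x$; and compositions $\bar f\cdot\bar g:\bar x\to_{(f_1\cdot g_1,f_2\cdot g_2)}\bar z$; unital and associative up to $=_*$. A displayed morphism $\bar f:\bar x\to_{(f_1,f_2)}\bar y$ over isomorphisms $f_1,f_2$ is an isomorphism if there is $\bar g:\bar y\to_{(f_1^{-1},f_2^{-1})}\bar x$ with $\bar f\cdot\bar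 g=_*\overline{\mathsf{id}}_{\bar x}$ and $\bar g\cdot\bar f=_*\overline{\mathsf{id}}_{\bar y}$. $D$ is univalent if for all $\bar x,\bar y:D_{(x_1,x_2)}$ the canonical map from $\bar x=\bar y$ to isomorphisms $\bar x\to_{(\mathsf{id},\mathsf{id})}\bar y$ is an equivalence of types. A 2-sided displayed functor $\bar F$ from $D$ (over $C,C$) to $D'$ (over $C',C'$) over $F:C\to C'$ on both sides sends $\bar x:D_{(x_1,x_2)}$ to $\bar F(\bar x):D'_{(Fx_1,Fx_2)}$ and $\bar f:\bar x\to_{(f_1,f_2)}\bar y$ to $\bar F(\bar f):\bar F(\bar x)\to_{(Ff_1,Ff_2)}\bar F(\bar y)$, preserving identities and composition up to $=_*$. A 2-sided displayed natural transformation $\bar\tau:\bar F\Rightarrow\bar G$ over $\tau:F\Rightarrow G$ on both sides assigns to each $\bar x:D_{(x_1,x_2)}$ a morphism $\bar\tau(\bar x):\bar F(\bar x)\to_{(\tau_{x_1},\tau_{x_2})}\bar G(\bar x)$ with $\bar F(\bar f)\cdot\bar\tau(\bar y)=_*\bar\tau(\bar x)\cdot\bar G(\bar f)$. The bicategory $\mathsf{DoubleCat}$. Objects (univalent double categories): a univalent category $C$ and a univalent 2-sided displayed category $D$ over $C$ and $C$ with: horizontal identities, i.e. $\mathsf{id}_h(x):D_{(x,x)}$ and $\mathsf{id}_{sq}(v):\mathsf{id}_h(x)\to_{(v,v)}\mathsf{id}_h(y)$ for $v:x\to y$, functorial in $v$; horizontal composition, i.e. $h\odot k:D_{(x,z)}$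 for $h:D_{(x,y)}$, $k:D_{(y,z)}$, and $s_1\odot s_2:h_1\odot k_1\to_{(v_1,v_3)}h_2\odot k_2$ for $s_1:h_1\to_{(v_1,v_2)}h_2$, $s_2:k_1\to_{(v_2,v_3)}k_2$, with $\overline{\mathsf{id}}_h\odot\overline{\mathsf{id}}_k=\overline{\mathsf{id}}_{h\odot k}$ and $(s_1\cdot t_1)\odot(s_2\cdot t_2)=(s_1\odot s_2)\cdot(t_1\odot t_2)$; displayed isomorphisms over identities $\lambda_h:\mathsf{id}_h(x)\odot h\to h$, $\rho_h:h\odot\mathsf{id}_h(y)\to h$, $\alpha_{h_1,h_2,h_3}:h_1\odot(h_2\odot h_3)\to(h_1\odot h_2)\odot h_3$, natural: $(\mathsf{id}_{sq}(v)\odot s)\cdot\lambda_k=_*\lambda_h\cdot s$, $(s\odot\mathsf{id}_{sq}(w))\cdot\rho_k=_*\rho_h\cdot s$ for $s:h\to_{(v,w)}k$, and $(s_1\odot(s_2\odot s_3))\cdot\alpha=_*\alpha\cdot((s_1\odot s_2)\odot s_3)$; satisfying the triangle law $\overline{\mathsf{id}}_h\odot\lambda_k=_*\alpha_{h,\mathsf{id}_h(y),k}\cdot(\rho_h\odot\overline{\mathsf{id}}_k)$ and the pentagon law $\alpha_{h_1,h_2,h_3\odot h_4}\cdot\alpha_{h_1\odot h_2,h_3,h_4}=_*(\overline{\mathsf{id}}_{h_1}\odot\alpha_{h_2,h_3,h_4})\cdot\alpha_{h_1,h_2\odot h_3,h_4}\cdot(\alpha_{h_1,h_2,h_3}\odot\overline{\mathsf{id}}_{h_4})$.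 1-cells (lax double functors): a functor $F$ and a 2-sided displayed functor $\bar F$ over $F,F$ (also written $F$) with squares $F_{\mathsf{id}}(x):\mathsf{id}_h(Fx)\to_{(\mathsf{id},\mathsf{id})}F(\mathsf{id}_h(x))$ and $F_{\mathsf{comp}}(h,k):F(h)\odot F(k)\to_{(\mathsf{id},\mathsf{id})}F(h\odot k)$ (not required invertible), natural: $\mathsf{id}_{sq}(Fv)\cdot F_{\mathsf{id}}(y)=_*F_{\mathsf{id}}(x)\cdot F(\mathsf{id}_{sq}(v))$ and $(F(s_1)\odot F(s_2))\cdot F_{\mathsf{comp}}(h_2,k_2)=_*F_{\mathsf{comp}}(h_1,k_1)\cdot F(s_1\odot s_2)$; such that $\lambda_{F(h)}=_*(F_{\mathsf{id}}(x)\odot\overline{\mathsf{id}})\cdot F_{\mathsf{comp}}(\mathsf{id}_h(x),h)\cdot F(\lambda_h)$, $\rho_{F(h)}=_*(\overline{\mathsf{id}}\odot F_{\mathsf{id}}(y))\cdot F_{\mathsf{comp}}(h,\mathsf{id}_h(y))\cdot F(\rho_h)$, and $\alpha_{Fh_1,Fh_2,Fh_3}\cdot(F_{\mathsf{comp}}(h_1,h_2)\odot\overline{\mathsf{id}})\cdot F_{\mathsf{comp}}(h_1\odot h_2,h_3)=_*(\overline{\mathsf{id}}\odot F_{\mathsf{comp}}(h_2,h_3))\cdot F_{\mathsf{comp}}(h_1,h_2\odot h_3)\cdot F(\alpha_{h_1,h_2,h_3})$. 2-cells from $F$ to $G$: a natural transformation $\tau:F\Rightarrow G$ and a 2-sided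 displayed natural transformation $\bar\tau:\bar F\Rightarrow\bar G$ over $\tau,\tau$ with $F_{\mathsf{id}}(x)\cdot\bar\tau(\mathsf{id}_h(x))=_*\mathsf{id}_{sq}(\tau_x)\cdot G_{\mathsf{id}}(x)$ and $F_{\mathsf{comp}}(h,k)\cdot\bar\tau(h\odot k)=_*(\bar\tau(h)\odot\bar\tau(k))\cdot G_{\mathsf{comp}}(h,k)$. Vertical composition and identities of 2-cells are componentwise. *)

(* Defs.v *)
(** Identity types are rendered by [eq], and no axiom is used.  Properties which
    are propositions of univalent foundations but carry data (being an
    equivalence, being an isomorphism) are [Type]-valued, so that inverses can be
    extracted without a choice principle.  Composition is in diagrammatic order. *)

From Stdlib Require Import CRelationClasses.

Definition is_hset (A : Type) : Type := forall (x y : A) (p q : x = y), p = q.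

Definition is_contr (A : Type) : Type := { a : A | forall b : A, b = a }.

Definition is_equiv {A B : Type} (f : A -> B) : Type :=
  forall b : B, is_contr { a : A | f a = b }.

Declare Scope dbl_scope.
Delimit Scope dbl_scope with dbl.
Open Scope dbl_scope.

Reserved Notation "x --> y" (at level 55, no associativity).
Reserved Notation "f · g" (at level 40, left associativity).
Reserved Notation "a -->[ f , g ] b"
  (at level 55, f at level 54, g at level 54, no associativity).
Reserved Notation "s ;; t" (at level 40, left associativity).
Reserved Notation "s =* t" (at level 70, no associativity).

Record category : Type := {
  ob :> Type;
  hom : ob -> ob -> Type where "x --> y" := (hom x y);
  id : forall x, x --> x;
  comp : forall {x y z}, x --> y -> y --> z -> x --> z
    where "f · g" := (comp f g);
  id_left : forall x y (f : x --> y), id x · f = f;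
  id_right : forall x y (f : x --> y), f · id y = f;
  comp_assoc : forall w x y z (f : w --> x) (g : x --> y) (h : y --> z),
    f · (g · h) = (f · g) · h;
  hom_is_hset : forall x y, is_hset (x --> y)
}.

Arguments hom {_} _ _.
Arguments id {_} _.
Arguments comp {_ _ _ _} _ _.
Arguments id_left {_ _ _} _.
Arguments id_right {_ _ _} _.
Arguments comp_assoc {_ _ _ _ _} _ _ _.
Arguments hom_is_hset {_} _ _.

Notation "x --> y" := (hom x y) : dbl_scope.
Notation "f · g" := (comp f g) : dbl_scope.

Definition is_iso {C : category} {x y : C} (f : x --> y) : Type :=
  { g : y --> x | f · g = id x /\ g · f = id y }.

Definition inv_of {C : category} {x y : C} {f : x --> y} (i : is_iso f) : y --> x :=
  proj1_sig i.

Definition iso {C : category} (x y : C) : Type := { f : x --> y & is_iso f }.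

Definition id_is_iso {C : category} (x : C) : is_iso (id x) :=
  exist _ (id x) (conj (id_left (id x)) (id_left (id x))).

Definition idtoiso {C : category} {x y : C} (p : x = y) : iso x y :=
  match p in _ = y return iso x y with
  | eq_refl => existT _ (id x) (id_is_iso x)
  end.

Definition is_univalent (C : category) : Type :=
  forall x y : C, is_equiv (@idtoiso C x y).

Record functor (C D : category) : Type := {
  fob :> C -> D;
  fmor : forall {x y : C}, x --> y -> fob x --> fob y;
  fmor_id : forall x : C, fmor (id x) = id (fob x);
  fmor_comp : forall (x y z : C) (f : x --> y) (g : y --> z),
    fmor (f · g) = fmor f · fmor g
}.

Arguments fmor {_ _} _ {_ _} _.
Arguments fmor_id {_ _} _ _.
Arguments fmor_comp {_ _} _ {_ _ _} _ _.

Record nat_trans {C D : category} (F G : functor C D) : Type := {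
  nt_ob :> forall x : C, F x --> G x;
  nt_natural : forall (x y : C) (f : x --> y),
    fmor F f · nt_ob y = nt_ob x · fmor G f
}.

Arguments nt_natural {_ _ _ _} _ {_ _} _.

Record twosided_disp_data (C1 C2 : category) : Type := {
  dob :> C1 -> C2 -> Type;
  dmor : forall {x1 y1 : C1} {x2 y2 : C2},
    dob x1 x2 -> dob y1 y2 -> x1 --> y1 -> x2 --> y2 -> Type;
  did : forall {x1 : C1} {x2 : C2} (a : dob x1 x2), dmor a a (id x1) (id x2);
  dcomp : forall {x1 y1 z1 : C1} {x2 y2 z2 : C2}
    {a : dob x1 x2} {b : dob y1 y2} {c : dob z1 z2}
    {f1 : x1 --> y1} {f2 : x2 --> y2} {g1 : y1 --> z1} {g2 : y2 --> z2},
    dmor a b f1 f2 -> dmor b c g1 g2 -> dmor a c (f1 · g1) (f2 · g2)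
}.

Arguments dmor {_ _ _ _ _ _ _} _ _ _ _.
Arguments did {_ _ _ _ _} _.
Arguments dcomp {_ _ _ _ _ _ _ _ _ _ _ _ _ _ _ _} _ _.

Notation "a -->[ f , g ] b" := (dmor a b f g) : dbl_scope.
Notation "s ;; t" := (dcomp s t) : dbl_scope.

Definition transport2 {C1 C2 : category} {D : twosided_disp_data C1 C2}
  {x1 y1 : C1} {x2 y2 : C2} {a : D x1 x2} {b : D y1 y2}
  {f1 g1 : x1 --> y1} {f2 g2 : x2 --> y2} (p1 : f1 = g1) (p2 : f2 = g2)
  (s : a -->[f1, f2] b) : a -->[g1, g2] b :=
  eq_rect f2 (fun k => a -->[g1, k] b)
    (eq_rect f1 (fun k => a -->[k, f2] b) s g1 p1) g2 p2.

(** Equality of displayed morphisms over equalities in the base.  The base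
    equalities are between elements of hom-sets, hence unique: quantifying
    existentially over them is the same as transporting along the one given by
    the category, functor or naturality laws. *)
Definition over_eq {C1 C2 : category} {D : twosided_disp_data C1 C2}
  {x1 y1 : C1} {x2 y2 : C2} {a : D x1 x2} {b : D y1 y2}
  {f1 g1 : x1 --> y1} {f2 g2 : x2 --> y2}
  (s : a -->[f1, f2] b) (t : a -->[g1, g2] b) : Prop :=
  exists (p1 : f1 = g1) (p2 : f2 = g2), transport2 p1 p2 s = t.

Notation "s =* t" := (over_eq s t) : dbl_scope.

Record twosided_disp_cat (C1 C2 : category) : Type := {
  disp_data :> twosided_disp_data C1 C2;
  did_left : forall (x1 y1 : C1) (x2 y2 : C2)
    (a : disp_data x1 x2) (b : disp_data y1 y2)
    (f1 : x1 --> y1) (f2 : x2 --> y2) (s : a -->[f1, f2] b),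
    did a ;; s =* s;
  did_right : forall (x1 y1 : C1) (x2 y2 : C2)
    (a : disp_data x1 x2) (b : disp_data y1 y2)
    (f1 : x1 --> y1) (f2 : x2 --> y2) (s : a -->[f1, f2] b),
    s ;; did b =* s;
  dcomp_assoc : forall (w1 x1 y1 z1 : C1) (w2 x2 y2 z2 : C2)
    (a : disp_data w1 w2) (b : disp_data x1 x2)
    (c : disp_data y1 y2) (d : disp_data z1 z2)
    (f1 : w1 --> x1) (f2 : w2 --> x2) (g1 : x1 --> y1) (g2 : x2 --> y2)
    (h1 : y1 --> z1) (h2 : y2 --> z2)
    (s : a -->[f1, f2] b) (t : b -->[g1, g2] c) (u : c -->[h1, h2] d),
    s ;; (t ;; u) =* (s ;; t) ;; u;
  dmor_is_hset : forall (x1 y1 : C1) (x2 y2 : C2)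
    (a : disp_data x1 x2) (b : disp_data y1 y2)
    (f1 : x1 --> y1) (f2 : x2 --> y2),
    is_hset (a -->[f1, f2] b)
}.

Arguments did_left {_ _} _ {_ _ _ _ _ _ _ _} _.
Arguments did_right {_ _} _ {_ _ _ _ _ _ _ _} _.
Arguments dcomp_assoc {_ _} _ {_ _ _ _ _ _ _ _ _ _ _ _ _ _ _ _ _ _} _ _ _.
Arguments dmor_is_hset {_ _} _ {_ _ _ _} _ _ _ _.

Definition is_disp_iso {C1 C2 : category} {D : twosided_disp_cat C1 C2}
  {x1 y1 : C1} {x2 y2 : C2} {a : D x1 x2} {b : D y1 y2}
  {f1 : x1 --> y1} {f2 : x2 --> y2} (i1 : is_iso f1) (i2 : is_iso f2)
  (s : a -->[f1, f2] b) : Type :=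
  { t : b -->[inv_of i1, inv_of i2] a | s ;; t =* did a /\ t ;; s =* did b }.

Definition is_globular_iso {C1 C2 : category} {D : twosided_disp_cat C1 C2}
  {x1 : C1} {x2 : C2} {a b : D x1 x2} (s : a -->[id x1, id x2] b) : Type :=
  is_disp_iso (id_is_iso x1) (id_is_iso x2) s.

Definition globular_iso {C1 C2 : category} {D : twosided_disp_cat C1 C2}
  {x1 : C1} {x2 : C2} (a b : D x1 x2) : Type :=
  { s : a -->[id x1, id x2] b & is_globular_iso s }.

Definition did_is_globular_iso {C1 C2 : category} {D : twosided_disp_cat C1 C2}
  {x1 : C1} {x2 : C2} (a : D x1 x2) : is_globular_iso (did a) :=
  exist _ (did a) (conj (did_left D (did a)) (did_left D (did a))).

Definition idtoiso_disp {C1 C2 : category} {D : twosided_disp_cat C1 C2}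
  {x1 : C1} {x2 : C2} {a b : D x1 x2} (p : a = b) : globular_iso a b :=
  match p in _ = b return globular_iso a b with
  | eq_refl => existT _ (did a) (did_is_globular_iso a)
  end.

Definition is_univalent_disp {C1 C2 : category} (D : twosided_disp_cat C1 C2) : Type :=
  forall (x1 : C1) (x2 : C2) (a b : D x1 x2),
    is_equiv (@idtoiso_disp C1 C2 D x1 x2 a b).

Record disp_functor {C C' : category} (F : functor C C')
  (D : twosided_disp_cat C C) (D' : twosided_disp_cat C' C') : Type := {
  dfob :> forall {x1 x2 : C}, D x1 x2 -> D' (F x1) (F x2);
  dfmor : forall {x1 y1 x2 y2 : C} {a : D x1 x2} {b : D y1 y2}
    {f1 : x1 --> y1} {f2 : x2 --> y2},
    a -->[f1, f2] b -> dfob a -->[fmor F f1, fmor F f2] dfob b;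
  dfmor_id : forall (x1 x2 : C) (a : D x1 x2), dfmor (did a) =* did (dfob a);
  dfmor_comp : forall (x1 y1 z1 x2 y2 z2 : C)
    (a : D x1 x2) (b : D y1 y2) (c : D z1 z2)
    (f1 : x1 --> y1) (f2 : x2 --> y2) (g1 : y1 --> z1) (g2 : y2 --> z2)
    (s : a -->[f1, f2] b) (t : b -->[g1, g2] c),
    dfmor (s ;; t) =* dfmor s ;; dfmor t
}.

Arguments dfob {_ _ _ _ _} _ {_ _} _.
Arguments dfmor {_ _ _ _ _} _ {_ _ _ _ _ _ _ _} _.
Arguments dfmor_id {_ _ _ _ _} _ {_ _} _.
Arguments dfmor_comp {_ _ _ _ _} _ {_ _ _ _ _ _ _ _ _ _ _ _ _} _ _.

Record disp_nat_trans {C C' : category} {F G : functor C C'} (tau : nat_trans F G)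
  {D : twosided_disp_cat C C} {D' : twosided_disp_cat C' C'}
  (FF : disp_functor F D D') (GG : disp_functor G D D') : Type := {
  dnt_ob :> forall {x1 x2 : C} (a : D x1 x2), FF _ _ a -->[tau x1, tau x2] GG _ _ a;
  dnt_natural : forall (x1 y1 x2 y2 : C) (a : D x1 x2) (b : D y1 y2)
    (f1 : x1 --> y1) (f2 : x2 --> y2) (s : a -->[f1, f2] b),
    dfmor FF s ;; dnt_ob b =* dnt_ob a ;; dfmor GG s
}.

Arguments dnt_ob {_ _ _ _ _ _ _ _ _} _ {_ _} _.
Arguments dnt_natural {_ _ _ _ _ _ _ _ _} _ {_ _ _ _ _ _ _ _} _.

Record univalent_double_cat : Type := {
  ver :> category;
  sq : twosided_disp_cat ver ver;
  ver_univalent : is_univalent ver;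
  sq_univalent : is_univalent_disp sq;

  hid : forall x : ver, sq x x;
  hid_sq : forall {x y : ver} (v : x --> y), hid x -->[v, v] hid y;
  hid_sq_id : forall x : ver, hid_sq (id x) = did (hid x);
  hid_sq_comp : forall (x y z : ver) (v : x --> y) (w : y --> z),
    hid_sq (v · w) = hid_sq v ;; hid_sq w;

  hcomp : forall {x y z : ver}, sq x y -> sq y z -> sq x z;
  hcomp_sq : forall {x1 x2 y1 y2 z1 z2 : ver}
    {h1 : sq x1 y1} {h2 : sq x2 y2} {k1 : sq y1 z1} {k2 : sq y2 z2}
    {v1 : x1 --> x2} {v2 : y1 --> y2} {v3 : z1 --> z2},
    h1 -->[v1, v2] h2 -> k1 -->[v2, v3] k2 ->
    hcomp h1 k1 -->[v1, v3] hcomp h2 k2;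
  hcomp_sq_id : forall (x y z : ver) (h : sq x y) (k : sq y z),
    hcomp_sq (did h) (did k) = did (hcomp h k);
  hcomp_sq_comp : forall (x1 x2 x3 y1 y2 y3 z1 z2 z3 : ver)
    (h1 : sq x1 y1) (h2 : sq x2 y2) (h3 : sq x3 y3)
    (k1 : sq y1 z1) (k2 : sq y2 z2) (k3 : sq y3 z3)
    (u1 : x1 --> x2) (u2 : y1 --> y2) (u3 : z1 --> z2)
    (w1 : x2 --> x3) (w2 : y2 --> y3) (w3 : z2 --> z3)
    (s1 : h1 -->[u1, u2] h2) (t1 : h2 -->[w1, w2] h3)
    (s2 : k1 -->[u2, u3] k2) (t2 : k2 -->[w2, w3] k3),
    hcomp_sq (s1 ;; t1) (s2 ;; t2) = hcomp_sq s1 s2 ;; hcomp_sq t1 t2;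

  lunitor : forall {x y : ver} (h : sq x y), hcomp (hid x) h -->[id x, id y] h;
  lunitor_iso : forall (x y : ver) (h : sq x y), is_globular_iso (lunitor h);
  lunitor_natural : forall (x1 x2 y1 y2 : ver) (h : sq x1 y1) (k : sq x2 y2)
    (v : x1 --> x2) (w : y1 --> y2) (s : h -->[v, w] k),
    hcomp_sq (hid_sq v) s ;; lunitor k =* lunitor h ;; s;

  runitor : forall {x y : ver} (h : sq x y), hcomp h (hid y) -->[id x, id y] h;
  runitor_iso : forall (x y : ver) (h : sq x y), is_globular_iso (runitor h);
  runitor_natural : forall (x1 x2 y1 y2 : ver) (h : sq x1 y1) (k : sq x2 y2)
    (v : x1 --> x2) (w : y1 --> y2) (s : h -->[v, w] k),
    hcomp_sq s (hid_sq w) ;; runitor k =* runitor h ;; s;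

  associator : forall {w x y z : ver} (h1 : sq w x) (h2 : sq x y) (h3 : sq y z),
    hcomp h1 (hcomp h2 h3) -->[id w, id z] hcomp (hcomp h1 h2) h3;
  associator_iso : forall (w x y z : ver) (h1 : sq w x) (h2 : sq x y) (h3 : sq y z),
    is_globular_iso (associator h1 h2 h3);
  associator_natural : forall (w1 w2 x1 x2 y1 y2 z1 z2 : ver)
    (h1 : sq w1 x1) (k1 : sq w2 x2) (h2 : sq x1 y1) (k2 : sq x2 y2)
    (h3 : sq y1 z1) (k3 : sq y2 z2)
    (v1 : w1 --> w2) (v2 : x1 --> x2) (v3 : y1 --> y2) (v4 : z1 --> z2)
    (s1 : h1 -->[v1, v2] k1) (s2 : h2 -->[v2, v3] k2) (s3 : h3 -->[v3, v4] k3),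
    hcomp_sq s1 (hcomp_sq s2 s3) ;; associator k1 k2 k3
    =* associator h1 h2 h3 ;; hcomp_sq (hcomp_sq s1 s2) s3;

  triangle : forall (x y z : ver) (h : sq x y) (k : sq y z),
    hcomp_sq (did h) (lunitor k)
    =* associator h (hid y) k ;; hcomp_sq (runitor h) (did k);
  pentagon : forall (v w x y z : ver)
    (h1 : sq v w) (h2 : sq w x) (h3 : sq x y) (h4 : sq y z),
    associator h1 h2 (hcomp h3 h4) ;; associator (hcomp h1 h2) h3 h4
    =* hcomp_sq (did h1) (associator h2 h3 h4)
       ;; associator h1 (hcomp h2 h3) h4
       ;; hcomp_sq (associator h1 h2 h3) (did h4)
}.

Arguments sq {_}.
Arguments hid {_} _.
Arguments hid_sq {_ _ _} _.
Arguments hid_sq_id {_} _.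
Arguments hid_sq_comp {_ _ _ _} _ _.
Arguments hcomp {_ _ _ _} _ _.
Arguments hcomp_sq {_ _ _ _ _ _ _ _ _ _ _ _ _ _} _ _.
Arguments hcomp_sq_id {_ _ _ _} _ _.
Arguments hcomp_sq_comp {_ _ _ _ _ _ _ _ _ _ _ _ _ _ _ _ _ _ _ _ _ _} _ _ _ _.
Arguments lunitor {_ _ _} _.
Arguments runitor {_ _ _} _.
Arguments associator {_ _ _ _ _} _ _ _.

Record lax_double_functor (C D : univalent_double_cat) : Type := {
  ldf_functor : functor C D;
  ldf_disp : disp_functor ldf_functor (@sq C) (@sq D);
  lax_id : forall x : C,
    hid (ldf_functor x)
      -->[id (ldf_functor x), id (ldf_functor x)] dfob ldf_disp (hid x);
  lax_comp : forall {x y z : C} (h : sq x y) (k : sq y z),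
    hcomp (dfob ldf_disp h) (dfob ldf_disp k)
      -->[id (ldf_functor x), id (ldf_functor z)] dfob ldf_disp (hcomp h k);
  lax_id_natural : forall (x y : C) (v : x --> y),
    hid_sq (fmor ldf_functor v) ;; lax_id y =* lax_id x ;; dfmor ldf_disp (hid_sq v);
  lax_comp_natural : forall (x1 x2 y1 y2 z1 z2 : C)
    (h1 : sq x1 y1) (h2 : sq x2 y2) (k1 : sq y1 z1) (k2 : sq y2 z2)
    (v1 : x1 --> x2) (v2 : y1 --> y2) (v3 : z1 --> z2)
    (s1 : h1 -->[v1, v2] h2) (s2 : k1 -->[v2, v3] k2),
    hcomp_sq (dfmor ldf_disp s1) (dfmor ldf_disp s2) ;; lax_comp h2 k2
    =* lax_comp h1 k1 ;; dfmor ldf_disp (hcomp_sq s1 s2);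
  lax_lunitor : forall (x y : C) (h : sq x y),
    lunitor (dfob ldf_disp h)
    =* hcomp_sq (lax_id x) (did (dfob ldf_disp h))
       ;; lax_comp (hid x) h
       ;; dfmor ldf_disp (lunitor h);
  lax_runitor : forall (x y : C) (h : sq x y),
    runitor (dfob ldf_disp h)
    =* hcomp_sq (did (dfob ldf_disp h)) (lax_id y)
       ;; lax_comp h (hid y)
       ;; dfmor ldf_disp (runitor h);
  lax_associator : forall (w x y z : C) (h1 : sq w x) (h2 : sq x y) (h3 : sq y z),
    associator (dfob ldf_disp h1) (dfob ldf_disp h2) (dfob ldf_disp h3)
    ;; hcomp_sq (lax_comp h1 h2) (did (dfob ldf_disp h3))
    ;; lax_comp (hcomp h1 h2) h3
    =* hcomp_sq (did (dfob ldf_disp h1)) (lax_comp h2 h3)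
       ;; lax_comp h1 (hcomp h2 h3)
       ;; dfmor ldf_disp (associator h1 h2 h3)
}.

Arguments ldf_functor {_ _} _.
Arguments ldf_disp {_ _} _.
Arguments lax_id {_ _} _ _.
Arguments lax_comp {_ _} _ {_ _ _} _ _.

Record dbl_2cell {C D : univalent_double_cat} (F G : lax_double_functor C D) : Type := {
  cell_nt : nat_trans (ldf_functor F) (ldf_functor G);
  cell_dnt : disp_nat_trans cell_nt (ldf_disp F) (ldf_disp G);
  cell_id : forall x : C,
    lax_id F x ;; dnt_ob cell_dnt (hid x) =* hid_sq (cell_nt x) ;; lax_id G x;
  cell_comp : forall (x y z : C) (h : sq x y) (k : sq y z),
    lax_comp F h k ;; dnt_ob cell_dnt (hcomp h k)
    =* hcomp_sq (dnt_ob cell_dnt h) (dnt_ob cell_dnt k) ;; lax_comp G h k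
}.

Arguments cell_nt {_ _ _ _} _.
Arguments cell_dnt {_ _ _ _} _.
Arguments cell_id {_ _ _ _} _ _.
Arguments cell_comp {_ _ _ _} _ {_ _ _} _ _.

Section OverEq.
  Context {C1 C2 : category} {D : twosided_disp_data C1 C2}.
  Context {x1 y1 : C1} {x2 y2 : C2} {a : D x1 x2} {b : D y1 y2}.

  Lemma over_refl {f1 : x1 --> y1} {f2 : x2 --> y2}
    {s t : a -->[f1, f2] b} (e : s = t) : s =* t.
  Proof. now exists eq_refl, eq_refl. Qed.

  Lemma over_sym {f1 g1 : x1 --> y1} {f2 g2 : x2 --> y2}
    {s : a -->[f1, f2] b} {t : a -->[g1, g2] b} : s =* t -> t =* s.
  Proof. intros [p1 [p2 e]]; destruct p1, p2; now apply over_refl. Qed.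

  Lemma over_trans {f1 g1 h1 : x1 --> y1} {f2 g2 h2 : x2 --> y2}
    {s : a -->[f1, f2] b} {t : a -->[g1, g2] b} {u : a -->[h1, h2] b} :
    s =* t -> t =* u -> s =* u.
  Proof.
    intros [p1 [p2 e]] [q1 [q2 e']]; destruct p1, p2, q1, q2; cbn in *.
    apply over_refl; congruence.
  Qed.

  Lemma over_comp {z1 : C1} {z2 : C2} {c : D z1 z2}
    {f1 g1 : x1 --> y1} {f2 g2 : x2 --> y2} {h1 k1 : y1 --> z1} {h2 k2 : y2 --> z2}
    {s : a -->[f1, f2] b} {s' : a -->[g1, g2] b}
    {t : b -->[h1, h2] c} {t' : b -->[k1, k2] c} :
    s =* s' -> t =* t' -> s ;; t =* s' ;; t'.
  Proof.
    intros [p1 [p2 e]] [q1 [q2 e']]; destruct p1, p2, q1, q2; cbn in *.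
    exists eq_refl, eq_refl; cbn; congruence.
  Qed.
End OverEq.

Definition nt_id {C D : category} (F : functor C D) : nat_trans F F.
Proof.
  refine {| nt_ob := fun x => id (F x) |}.
  abstract (intros; now rewrite id_left, id_right).
Defined.

Definition nt_comp {C D : category} {F G H : functor C D}
  (sigma : nat_trans F G) (tau : nat_trans G H) : nat_trans F H.
Proof.
  refine {| nt_ob := fun x => sigma x · tau x |}.
  abstract (intros; now rewrite comp_assoc, nt_natural,
    <- comp_assoc, nt_natural, comp_assoc).
Defined.

Definition dnt_id {C C' : category} {F : functor C C'}
  {D : twosided_disp_cat C C} {D' : twosided_disp_cat C' C'}
  (FF : disp_functor F D D') : disp_nat_trans (nt_id F) FF FF.
Proof.
  refine {| dnt_ob := fun x1 x2 a => did (FF x1 x2 a) : _ -->[nt_id F x1, nt_id F x2] _ |}.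
  abstract (intros; exact (over_trans (did_right D' _) (over_sym (did_left D' _)))).
Defined.

Definition dnt_comp {C C' : category} {F G H : functor C C'}
  {sigma : nat_trans F G} {tau : nat_trans G H}
  {D : twosided_disp_cat C C} {D' : twosided_disp_cat C' C'}
  {FF : disp_functor F D D'} {GG : disp_functor G D D'} {HH : disp_functor H D D'}
  (ssigma : disp_nat_trans sigma FF GG) (ttau : disp_nat_trans tau GG HH) :
  disp_nat_trans (nt_comp sigma tau) FF HH.
Proof.
  refine {| dnt_ob := fun x1 x2 a => dnt_ob ssigma a ;; dnt_ob ttau a
              : _ -->[nt_comp sigma tau x1, nt_comp sigma tau x2] _ |}.
  abstract (intros;
    refine (over_trans (dcomp_assoc D' _ _ _) _);
    refine (over_trans (over_comp (dnt_natural ssigma s) (over_refl eq_refl)) _);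
    refine (over_trans (over_sym (dcomp_assoc D' _ _ _)) _);
    refine (over_trans (over_comp (over_refl eq_refl) (dnt_natural ttau s)) _);
    exact (dcomp_assoc D' _ _ _)).
Defined.

Definition cell_identity {C D : univalent_double_cat}
  (F : lax_double_functor C D) : dbl_2cell F F.
Proof.
  refine {| cell_nt := nt_id (ldf_functor F); cell_dnt := dnt_id (ldf_disp F) |}.
  - abstract (intro x; cbn; rewrite hid_sq_id;
      exact (over_trans (did_right sq _) (over_sym (did_left sq _)))).
  - abstract (intros x y z h k; cbn; rewrite hcomp_sq_id;
      exact (over_trans (did_right sq _) (over_sym (did_left sq _)))).
Defined.

Definition cell_vcomp {C D : univalent_double_cat} {F G H : lax_double_functor C D}
  (sigma : dbl_2cell F G) (tau : dbl_2cell G H) : dbl_2cell F H.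
Proof.
  refine {| cell_nt := nt_comp (cell_nt sigma) (cell_nt tau);
            cell_dnt := dnt_comp (cell_dnt sigma) (cell_dnt tau) |}.
  - abstract (intro x; cbn; rewrite hid_sq_comp;
      refine (over_trans (dcomp_assoc sq _ _ _) _);
      refine (over_trans (over_comp (cell_id sigma x) (over_refl eq_refl)) _);
      refine (over_trans (over_sym (dcomp_assoc sq _ _ _)) _);
      refine (over_trans (over_comp (over_refl eq_refl) (cell_id tau x)) _);
      exact (dcomp_assoc sq _ _ _)).
  - abstract (intros x y z h k; cbn; rewrite hcomp_sq_comp;
      refine (over_trans (dcomp_assoc sq _ _ _) _);
      refine (over_trans (over_comp (cell_comp sigma h k) (over_refl eq_refl)) _);
      refine (over_trans (over_sym (dcomp_assoc sq _ _ _)) _);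
      refine (over_trans (over_comp (over_refl eq_refl) (cell_comp tau h k)) _);
      exact (dcomp_assoc sq _ _ _)).
Defined.

Definition is_invertible_2cell {C D : univalent_double_cat}
  {F G : lax_double_functor C D} (tau : dbl_2cell F G) : Type :=
  { sigma : dbl_2cell G F |
    cell_vcomp tau sigma = cell_identity F /\ cell_vcomp sigma tau = cell_identity G }.

(* Main.v *)
Require Import Defs.
From Stdlib Require Import CRelationClasses.
From Stdlib Require Import FunctionalExtensionality.

(** A 2-cell is determined by its components, since its laws are equations in
    sets; so an invertible 2-cell is the same as one with an inverse family
    satisfying the 2-cell laws.  Each such law for the pointwise inverse is the
    corresponding law of the 2-cell with its vertical sides inverted: naturality
    uses the inverses of the components, and compatibility with the laxators uses
    that [hid_sq] and [hcomp_sq] are functorial, hence preserve inverses.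

    Only function extensionality is used: uniqueness of proofs of the laws is
    derived from the hom-set conditions, as proof irrelevance for [eq] would
    contradict the univalent reading. *)

Lemma nat_trans_eq {C D : category} {F G : functor C D} (s t : nat_trans F G) :
  (forall x, s x = t x) -> s = t.
Proof.
  destruct s as [s Hs], t as [t Ht]; cbn; intro e.
  assert (e' : s = t) by (extensionality x; apply e).
  subst t; f_equal.
  extensionality x; extensionality y; extensionality f.
  apply hom_is_hset.
Qed.

Section DispLemmas.
  Context {C1 C2 : category} {D : twosided_disp_cat C1 C2}.

  (** Hom-sets identify the base equalities; what remains is an equality inside a set of displayed
      morphisms. *)
  Lemma over_eq_irrelevant {x1 y1 : C1} {x2 y2 : C2} {a : D x1 x2} {b : D y1 y2}
    {f1 g1 : x1 --> y1} {f2 g2 : x2 --> y2}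
    {s : a -->[f1, f2] b} {t : a -->[g1, g2] b} (e e' : s =* t) : e = e'.
  Proof.
    destruct e as [p1 [p2 e]], e' as [q1 [q2 e']].
    destruct (hom_is_hset _ _ _ _ p1 q1), (hom_is_hset _ _ _ _ p2 q2).
    now destruct (dmor_is_hset D _ _ _ _ _ _ e e').
  Qed.

  Lemma over_eq_eq {x1 y1 : C1} {x2 y2 : C2} {a : D x1 x2} {b : D y1 y2}
    {f1 : x1 --> y1} {f2 : x2 --> y2} {s t : a -->[f1, f2] b} : s =* t -> s = t.
  Proof.
    intros [p1 [p2 e]].
    rewrite (hom_is_hset _ _ _ _ p1 eq_refl),
      (hom_is_hset _ _ _ _ p2 eq_refl) in e.
    exact e.
  Qed.

  (** Insert [v ;; u] in front of [q ;; v'], trade [u ;; q] for [p ;; u'], and cancel [u' ;; v'].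
      All the laws of the inverse 2-cell except naturality of its vertical part are instances of
      this. *)
  Lemma over_eq_square_inv {x1 y1 z1 w1 : C1} {x2 y2 z2 w2 : C2}
    {a : D x1 x2} {b : D y1 y2} {a' : D z1 z2} {b' : D w1 w2}
    {u1 : x1 --> y1} {u2 : x2 --> y2} {v1 : y1 --> x1} {v2 : y2 --> x2}
    {u1' : z1 --> w1} {u2' : z2 --> w2} {v1' : w1 --> z1} {v2' : w2 --> z2}
    {p1 : x1 --> z1} {p2 : x2 --> z2} {q1 : y1 --> w1} {q2 : y2 --> w2}
    {u : a -->[u1, u2] b} {v : b -->[v1, v2] a}
    {u' : a' -->[u1', u2'] b'} {v' : b' -->[v1', v2'] a'}
    {p : a -->[p1, p2] a'} {q : b -->[q1, q2] b'} :
    v ;; u =* did b -> u' ;; v' =* did a' ->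
    p ;; u' =* u ;; q -> q ;; v' =* v ;; p.
  Proof.
    intros vu uv' e.
    refine (over_trans (over_sym (did_left D _)) _).
    refine (over_trans (over_comp (over_sym vu) (over_refl eq_refl)) _).
    refine (over_trans (over_sym (dcomp_assoc D _ _ _)) _).
    refine (over_comp (over_refl eq_refl) _).
    refine (over_trans (dcomp_assoc D _ _ _) _).
    refine (over_trans (over_comp (over_sym e) (over_refl eq_refl)) _).
    refine (over_trans (over_sym (dcomp_assoc D _ _ _)) _).
    exact (over_trans (over_comp (over_refl eq_refl) uv') (did_right D _)).
  Qed.
End DispLemmas.

Lemma disp_nat_trans_eq {C C' : category} {F G : functor C C'} {tau : nat_trans F G}
  {D : twosided_disp_cat C C} {D' : twosided_disp_cat C' C'}
  {FF : disp_functor F D D'} {GG : disp_functor G D D'}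
  (s t : disp_nat_trans tau FF GG) :
  (forall x1 x2 (a : D x1 x2), dnt_ob s a =* dnt_ob t a) -> s = t.
Proof.
  destruct s as [s Hs], t as [t Ht]; cbn; intro e.
  assert (e' : s = t).
  { extensionality x1; extensionality x2; extensionality a.
    apply over_eq_eq, e. }
  subst t; f_equal.
  repeat (let z := fresh in extensionality z).
  apply over_eq_irrelevant.
Qed.

Lemma hcomp_sq_over {C : univalent_double_cat} {x1 x2 y1 y2 z1 z2 : C}
  {h1 : sq x1 y1} {h2 : sq x2 y2} {k1 : sq y1 z1} {k2 : sq y2 z2}
  {v1 v1' : x1 --> x2} {v2 v2' : y1 --> y2} {v3 v3' : z1 --> z2}
  {s : h1 -->[v1, v2] h2} {s' : h1 -->[v1', v2'] h2}
  {t : k1 -->[v2, v3] k2} {t' : k1 -->[v2', v3'] k2} :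
  s =* s' -> t =* t' -> hcomp_sq s t =* hcomp_sq s' t'.
Proof.
  intros [p1 [p2 e]] [q2 [q3 e']].
  (* Both squares share the middle side [v2], so the two proofs of [v2 = v2'] must be identified
     before either is eliminated. *)
  destruct (hom_is_hset _ _ _ _ p2 q2), p1, p2, q3; cbn in *.
  now subst; apply over_refl.
Qed.

Lemma hid_sq_over {C : univalent_double_cat} {x y : C} {v w : x --> y} :
  v = w -> hid_sq v =* hid_sq w.
Proof. intros []; now apply over_refl. Qed.

Lemma dbl_2cell_eq {C D : univalent_double_cat} {F G : lax_double_functor C D}
  (s t : dbl_2cell F G) :
  (forall x, cell_nt s x = cell_nt t x) ->
  (forall (x y : C) (h : sq x y), dnt_ob (cell_dnt s) h =* dnt_ob (cell_dnt t) h) ->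
  s = t.
Proof.
  destruct s as [s ss Hs1 Hs2], t as [t tt Ht1 Ht2]; cbn; intros e ee.
  (* The vertical parts come first: only then do [ss] and [tt] have the same type. *)
  apply nat_trans_eq in e; subst t.
  apply disp_nat_trans_eq in ee; subst tt.
  f_equal; repeat (let z := fresh in extensionality z); apply over_eq_irrelevant.
Qed.

Lemma dbl_2cell_eq_disp {C D : univalent_double_cat} {F G : lax_double_functor C D}
  {s t : dbl_2cell F G} (e : s = t) {x y : C} (h : sq x y) :
  dnt_ob (cell_dnt s) h =* dnt_ob (cell_dnt t) h.
Proof. destruct e; now apply over_refl. Qed.

(** Transparent, so that its components reduce to [inv_of (i x)], the sides over which the displayed
    inverses lie. *)
Definition nt_inverse {C D : category} {F G : functor C D} (tau : nat_trans F G)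
  (i : forall x, is_iso (tau x)) : nat_trans G F.
Proof.
  refine {| nt_ob := fun x => inv_of (i x) |}.
  intros x y f; unfold inv_of.
  destruct (i x) as [gx [? ex]], (i y) as [gy [ey ?]]; cbn.
  rewrite <- (id_left (fmor G f · gy)), <- ex, <- comp_assoc.
  rewrite (comp_assoc (tau x) _ gy), <- nt_natural, <- comp_assoc, ey.
  now rewrite id_right.
Defined.

Definition dnt_inverse {C C' : category} {F G : functor C C'} {tau : nat_trans F G}
  {D : twosided_disp_cat C C} {D' : twosided_disp_cat C' C'}
  {FF : disp_functor F D D'} {GG : disp_functor G D D'}
  (ttau : disp_nat_trans tau FF GG) (i : forall x, is_iso (tau x))
  (ii : forall x y (h : D x y), is_disp_iso (i x) (i y) (dnt_ob ttau h)) :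
  disp_nat_trans (nt_inverse tau i) GG FF.
Proof.
  refine {| dnt_ob := fun x y h => proj1_sig (ii x y h)
              : _ -->[nt_inverse tau i x, nt_inverse tau i y] _ |}.
  intros.
  exact (over_eq_square_inv (proj2 (proj2_sig (ii _ _ a)))
    (proj1 (proj2_sig (ii _ _ b))) (dnt_natural ttau s)).
Defined.

Definition cell_inverse {C D : univalent_double_cat} {F G : lax_double_functor C D}
  (tau : dbl_2cell F G) (i : forall x, is_iso (cell_nt tau x))
  (ii : forall (x y : C) (h : sq x y),
    is_disp_iso (i x) (i y) (dnt_ob (cell_dnt tau) h)) :
  dbl_2cell G F.
Proof.
  refine {| cell_nt := nt_inverse (cell_nt tau) i;
            cell_dnt := dnt_inverse (cell_dnt tau) i ii |}.
  - intro x; refine (over_eq_square_inv _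
      (proj1 (proj2_sig (ii _ _ (hid x)))) (cell_id tau x)).
    (* Functoriality of [hid_sq] reduces its inverse law to that of the vertical component. *)
    rewrite <- hid_sq_comp, <- hid_sq_id.
    exact (hid_sq_over (proj2 (proj2_sig (i x)))).
  - intros x y z h k; refine (over_eq_square_inv _
      (proj1 (proj2_sig (ii _ _ (hcomp h k)))) (cell_comp tau h k)).
    rewrite <- hcomp_sq_comp, <- hcomp_sq_id.
    exact (hcomp_sq_over (proj2 (proj2_sig (ii _ _ h)))
      (proj2 (proj2_sig (ii _ _ k)))).
Defined.

Theorem theorem7p1 (C D : univalent_double_cat) (F G : lax_double_functor C D)
  (tau : dbl_2cell F G) :
  iffT
    (is_invertible_2cell tau)
    { i : forall x : C, is_iso (cell_nt tau x) &
      forall (x y : C) (h : @sq C x y),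
        is_disp_iso (i x) (i y) (dnt_ob (cell_dnt tau) h) }.
Proof.
  split.
  - intros [sigma [e1 e2]].
    (* Choosing the components of [sigma] as inverses makes [inv_of] return exactly the sides of its
       squares, which can then serve as displayed inverses. *)
    exists (fun x => exist _ (cell_nt sigma x)
      (conj (f_equal (fun c => cell_nt c x) e1) (f_equal (fun c => cell_nt c x) e2))).
    intros x y h; exists (dnt_ob (cell_dnt sigma) h); split.
    + exact (dbl_2cell_eq_disp e1 h).
    + exact (dbl_2cell_eq_disp e2 h).
  - intros [i ii]; exists (cell_inverse tau i ii).
    (* Composition and identities are componentwise, so each goal is by conversion one of the given
       inverse laws. *)
    split; apply dbl_2cell_eq.
    + intro x; exact (proj1 (proj2_sig (i x))).
    + intros x y h; exact (proj1 (proj2_sig (ii x y h))).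
    + intro x; exact (proj2 (proj2_sig (i x))).
    + intros x y h; exact (proj2 (proj2_sig (ii x y h))).
Qed.
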